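(* Let $(R,\mathfrak{m})$ be a local ring of prime characteristic $p>0$ with $\dim R>0$, let $M$ be a finitely generated $R$-module, and let $s>0$ be a real number. Let $I_1,I_2$ be $\mathfrak{m}$-primary ideals of $R$, and let $J_1=I_1\ltimes I_1M$ and $J_2=I_2\ltimes I_2M$, ideals of the idealization $R\ltimes M$. Then $$e_s(J_1,J_2;R\ltimes M)=e_s(I_1,I_2;R)+e_s(I_1,I_2;M),$$ where the left-hand side is taken over the ring $R\ltimes M$ and the right-hand side over $R$.
   Context: All rings are commutative, Noetherian, local, with identity. Idealization: for a ring $R$ and an $R$-module $M$, $R\ltimes M$ is the set of pairs $(r,m)$, $r\in R$, $m\in M$, with componentwise addition and multiplication $(r,m)(r',m')=(rr',rm'+r'm)$. If $(R,\mathfrak{m})$ is local and $M$ is finitely generated, then $R\ltimes M$ is local with maximal ideal $\mathfrak{m}\ltimes M$, has the same characteristic as $R$, and $\dim(R\ltimes M)=\dim R$. For an ideal $I$ of $R$, $I\ltimes IM=\{(a,x):a\in I,\ x\in IM\}$, an ideal of $R\ltimes M$, which is $(\mathfrak{m}\ltimes M)$-primary if $I$ is $\mathfrak{m}$-primary. $s$-multiplicity: let $(A,\mathfrak{n})$ be a local ring of prime characteristic $p>0$ and dimension $d>0$, let $I,J$ be $\mathfrak{n}$-primary ideals, $N$ a finitely generated $A$-module, $s>0$ real. Put $$h_s(I,J;N)=\lim_{e\to\infty}\frac{\ell_A\big(N/(I^{\lceil sp^e\rceil}+J^{[p^e]})N\big)}{p^{ed}},\qquad d=\dim A,$$ where $\ell_A$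 is length and $J^{[p^e]}$ is the ideal generated by the $p^e$-th powers of elements of $J$ (the limit is known to exist), and $$e_s(I,J;N)=\frac{h_s(I,J;N)}{\mathcal{H}_s(d)},\qquad \mathcal{H}_s(d)=\sum_{i=0}^{\lfloor s\rfloor}\frac{(-1)^i}{d!}\binom{d}{i}(s-i)^d .$$ *)

(* Defs.v *)
From HB Require Import structures.
From mathcomp Require Import all_boot all_order all_algebra.
From mathcomp Require Import all_classical all_reals all_analysis.

Set Implicit Arguments.
Unset Strict Implicit.
Unset Printing Implicit Defensive.

Import Order.TTheory GRing.Theory Num.Theory.

Local Open Scope classical_set_scope.
Local Open Scope ring_scope.
Local Open Scope quotient_scope.

(** * Submodules *)

(* The submodule generated by S, i.e. the smallest one containing S.  Ideals
   of A are the submodules of A^o; MathComp's [idealr A] is the type of proper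
   ideals. *)
Section Span.
Variables (A : comNzRingType) (V : lmodType A).

Definition span (S : set V) : {pred V} :=
  fun v => `[< forall N : submodClosed V, (forall x, S x -> x \in N) -> v \in N >].

Lemma span_subsemimod_closed (S : set V) : subsemimod_closed (span S).
Proof.
split; first split.
- by apply/asboolP => N _; rewrite rpred0.
- by move=> u v /asboolP hu /asboolP hv; apply/asboolP => N SN;
     rewrite rpredD ?hu ?hv.
- by move=> a v /asboolP hv; apply/asboolP => N SN; rewrite rpredZ ?hv.
Qed.

HB.instance Definition _ (S : set V) :=
  GRing.isSubmodClosed.Build A V (span S) (span_subsemimod_closed S).

Definition finitely_generated (N : {pred V}) : Prop :=
  exists gs : seq V, N =i span [set x | x \in gs].

End Span.

(* The submodule I V of V *)
Definition ideal_mod (A : comNzRingType) (I : {pred A}) (V : lmodType A) :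
    {pred V} :=
  span [set a *: x | a in [set` I] & x in [set: V]].
Arguments ideal_mod {A} I V _.

HB.instance Definition _ (A : comNzRingType) (I : {pred A}) (V : lmodType A) :=
  GRing.SubmodClosed.on (ideal_mod I V).
HB.instance Definition _ (A : comNzRingType) (I : {pred A}) (V : lmodType A) :=
  GRing.ZmodClosed.on (ideal_mod I V).

(** * Quotient modules and length *)

Section QuotientModule.
Variables (A : comNzRingType) (V : lmodType A) (S : set V).

(* V / <S> *)
Definition quotmod := {ideal_quot span S}.

HB.instance Definition _ := GRing.Zmodule.on quotmod.

Definition quotmod_pi (v : V) : quotmod := \pi_{ideal_quot span S} v.

Lemma quotmod_repr (u : quotmod) : quotmod_pi (repr u) = u.
Proof. exact: reprK. Qed.

Lemma quotmod_piD : {morph quotmod_pi : u v / u + v}.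
Proof. by move=> u v; rewrite /quotmod_pi; apply: Quotient.pi_add. Qed.

Lemma quotmod_pi_eq (u v : V) : (quotmod_pi u == quotmod_pi v) = (u - v \in span S).
Proof. exact: esym (Quotient.idealrBE _ _ _). Qed.

Definition quotmod_scale (a : A) (u : quotmod) : quotmod :=
  quotmod_pi (a *: repr u).

Lemma quotmod_scale_pi a (v : V) :
  quotmod_scale a (quotmod_pi v) = quotmod_pi (a *: v).
Proof.
apply/eqP; rewrite quotmod_pi_eq -scalerBr rpredZ //.
by rewrite -quotmod_pi_eq quotmod_repr.
Qed.

Lemma quotmod_scaleA a b u :
  quotmod_scale a (quotmod_scale b u) = quotmod_scale (a * b) u.
Proof. by rewrite -(quotmod_repr u) !quotmod_scale_pi scalerA. Qed.

Lemma quotmod_scale1 : left_id 1 quotmod_scale.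
Proof. by move=> u; rewrite -(quotmod_repr u) quotmod_scale_pi scale1r. Qed.

Lemma quotmod_scaleDr : right_distributive quotmod_scale +%R.
Proof.
move=> a u v; rewrite -(quotmod_repr u) -(quotmod_repr v) -quotmod_piD.
by rewrite !quotmod_scale_pi -quotmod_piD scalerDr.
Qed.

Lemma quotmod_scaleDl u : {morph quotmod_scale^~ u : a b / a + b}.
Proof.
move=> a b; rewrite -(quotmod_repr u) !quotmod_scale_pi scalerDl.
exact: quotmod_piD.
Qed.

HB.instance Definition _ := GRing.Zmodule_isLmodule.Build A quotmod
  quotmod_scaleA quotmod_scale1 quotmod_scaleDr quotmod_scaleDl.

Lemma quotmod_piZ a : {morph quotmod_pi : v / a *: v}.
Proof. by move=> v; rewrite -quotmod_scale_pi. Qed.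

End QuotientModule.

(* Supremum of the n such that there is a chain N_0 < N_1 < ... < N_n of
   submodules of V; it is +oo when these n are unbounded. *)
Definition mod_length (K : realType) (A : comNzRingType) (V : lmodType A) :
    \bar K :=
  ereal_sup [set (n%:R%:E : \bar K) | n in
    [set n | exists N : nat -> submodClosed V,
       forall i, (i < n)%N -> [set` N i] `<` [set` N i.+1]]].

(** * Noetherian local rings *)

Definition noetherian (A : comNzRingType) : Prop :=
  forall I : submodClosed A^o, finitely_generated I.

Definition maximal_ideal (A : comNzRingType) (m : idealr A) : Prop :=
  forall I : idealr A, {subset m <= I} -> m =i I.

(* m is the unique maximal ideal of A. *)
Definition local_ring (A : comNzRingType) (m : idealr A) : Prop :=
  maximal_ideal m /\ forall m' : idealr A, maximal_ideal m' -> m' =i m.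

(* The value is 0 if the lengths of chains of primes are unbounded, which does
   not happen for a Noetherian local ring. *)
Definition krull_dim (A : comNzRingType) : nat :=
  supremum 0%N
    [set n | exists P : nat -> prime_idealr A,
       forall i, (i < n)%N -> [set` P i] `<` [set` P i.+1]].

Definition primary_ideal (A : comNzRingType) (I : idealr A) : Prop :=
  forall x y, x * y \in I -> x \in I \/ exists n : nat, y ^+ n \in I.

Definition primary_to (A : comNzRingType) (m I : idealr A) : Prop :=
  primary_ideal I /\ forall x, x \in m <-> exists n : nat, x ^+ n \in I.

(** * Operations on ideals *)

Section IdealOps.
Variable A : comNzRingType.
Implicit Types I J : {pred A}.

Definition ideal_add I J : {pred A} :=
  fun a => `[< exists x y, [/\ x \in I, y \in J & a = x + y] >].

(* Generated by the n-fold products of elements of I; for n = 0 this is A. *)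
Definition ideal_pow I (n : nat) : {pred A} :=
  span [set (\prod_(i < n) x i : A^o) | x in
          [set x : 'I_n -> A | forall i, x i \in I]].

(* J^[q] *)
Definition frobenius_pow J (q : nat) : {pred A} :=
  span [set (x ^+ q : A^o) | x in [set` J]].

End IdealOps.

(** * s-multiplicity *)

Section SMultiplicity.
Variables (K : realType) (p : nat) (s : K).

Definition s_mult_const (d : nat) : K :=
  \sum_(0 <= i < (Num.truncn s).+1)
    (-1) ^+ i / d`!%:R * 'C(d, i)%:R * (s - i%:R) ^+ d.

Section Ring.
Variables (A : comNzRingType) (I J : idealr A) (N : lmodType A).

(* I^(ceil (s p^e)) + J^[p^e] *)
Definition s_ideal (e : nat) : {pred A} :=
  ideal_add (ideal_pow I `|Num.ceil (s * p%:R ^+ e)|%N)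
            (frobenius_pow J (p ^ e)).

Definition s_quotient (e : nat) : lmodType A :=
  quotmod [set` ideal_mod (s_ideal e) N].

Definition h_seq (e : nat) : \bar K :=
  (mod_length K (s_quotient e) * ((p%:R ^+ (e * krull_dim A))^-1)%:E)%E.

Definition h_mult : \bar K := limn h_seq.

Definition s_mult : \bar K :=
  (h_mult * ((s_mult_const (krull_dim A))^-1)%:E)%E.

End Ring.
End SMultiplicity.

(** * Idealization *)

Definition idealization (R : comNzRingType) (M : lmodType R) : Type :=
  (R * M)%type.

Section Idealization.
Variables (R : comNzRingType) (M : lmodType R).
Local Notation RM := (idealization M).

HB.instance Definition _ := GRing.Zmodule.copy RM (R * M)%type.

Definition idealization_one : RM := (1, 0).
Definition idealization_mul (u v : RM) : RM :=
  (u.1 * v.1, u.1 *: v.2 + v.1 *: u.2).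

Lemma idealization_mulA : associative idealization_mul.
Proof.
move=> [a x] [b y] [c z]; rewrite /idealization_mul /=; congr pair.
  exact: mulrA.
by rewrite !scalerDr !scalerA addrA (mulrC c a) (mulrC c b).
Qed.

Lemma idealization_mulC : commutative idealization_mul.
Proof.
by move=> [a x] [b y]; rewrite /idealization_mul /= mulrC addrC.
Qed.

Lemma idealization_mul1 : left_id idealization_one idealization_mul.
Proof.
by move=> [a x]; rewrite /idealization_mul /= mul1r scale1r scaler0 addr0.
Qed.

Lemma idealization_mulDl : left_distributive idealization_mul +%R.
Proof.
move=> [a x] [b y] [c z]; rewrite /idealization_mul /=; congr pair => /=.
  exact: mulrDl.
by rewrite scalerDl scalerDr addrACA.
Qed.

Lemma idealization_one_neq0 : idealization_one != 0.
Proof. by apply/eqP => -[] /eqP; rewrite oner_eq0. Qed.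

HB.instance Definition _ := GRing.Zmodule_isComNzRing.Build RM
  idealization_mulA idealization_mulC idealization_mul1 idealization_mulDl
  idealization_one_neq0.

(* I |x IM *)
Definition idealization_ideal (I : idealr R) : {pred RM} :=
  fun u => (u.1 \in I) && (u.2 \in ideal_mod I M).

Lemma idealization_ideal_closed (I : idealr R) :
  idealr_closed (idealization_ideal I).
Proof.
split=> [||[a x] [b y] [c z] /andP[/= bI yI] /andP[/= cI zI]].
- by apply/andP; rewrite /= !rpred0.
- by apply/negP => /andP[/=]; rewrite idealr1.
- apply/andP; split=> /=; first by rewrite rpredD // idealMr.
  rewrite rpredD // rpredD //; first by rewrite rpredZ.
  by apply/asboolP => N; apply; exists b; last by exists x.
Qed.

HB.instance Definition _ (I : idealr R) :=
  isIdealr.Build RM (idealization_ideal I) (idealization_ideal_closed I).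

End Idealization.
Arguments idealization_ideal {R} M I _.

(* Main.v *)
(* The ideal J1^n + J2^[q] of R |x M equals S |x SM for S = I1^n + I2^[q]; the
   only point is that (a, x)^q = (a^q, q a^(q-1) x) has zero second component
   once q is a positive power of p.  So the quotient of R |x M by it is an
   extension of R / S by M / SM, and lengths add up.  The dimensions of R and
   R |x M agree because every prime contains the square-zero ideal 0 |x M. *)
Require Import Defs.
From HB Require Import structures.
From mathcomp Require Import all_boot all_order all_algebra.
From mathcomp Require Import all_classical all_reals all_analysis.

Import Order.TTheory GRing.Theory Num.Theory.
Local Open Scope classical_set_scope.
Local Open Scope ring_scope.

Set Implicit Arguments.
Unset Strict Implicit.
Unset Printing Implicit Defensive.

Local Notation span := Defs.span.

(** * Bundled submodules and spans *)

Section Submodules.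
Variables (A : comNzRingType) (V : lmodType A).

(** [span] quantifies over bundled submodules, so a predicate built by hand has to be packed before
    a span can be compared with it. *)
Definition submod_of (P : {pred V}) (P_closed : subsemimod_closed P) :
    submodClosed V :=
  HB.pack (P : V -> bool) (GRing.isSubmodClosed.Build A V P P_closed).

Lemma mem_span (S : set V) v : S v -> v \in span S.
Proof. by move=> Sv; apply/asboolP => N; exact. Qed.

Lemma submodB (N : submodClosed V) u v :
  u \in N -> v \in N -> u - v \in N.
Proof. by move=> Nu Nv; rewrite -scaleN1r rpredD ?rpredZ. Qed.

Lemma span_sub (S : set V) (N : submodClosed V) :
  (forall v, S v -> v \in N) -> {subset span S <= N}.
Proof. by move=> SN v /asboolP; exact. Qed.

(** [quotmod] always divides by a span; when the set is already a submodule, this reduces equality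
    of classes to membership in that submodule. *)
Lemma span_submod (N : submodClosed V) : span [set` N] =i N.
Proof.
move=> v; apply/idP/idP => [|Nv]; last exact: mem_span.
by apply: span_sub.
Qed.

Lemma span_sub_pred (S : set V) (P : {pred V}) : subsemimod_closed P ->
  (forall v, S v -> v \in P) -> {subset span S <= P}.
Proof. by move=> P_closed; apply: (@span_sub _ (submod_of P_closed)). Qed.

End Submodules.

(** * Strict chains of submodules and length *)

Section Chains.
Variables (A : comNzRingType) (V : lmodType A).

Definition chain (n : nat) (N : nat -> submodClosed V) : Prop :=
  forall i, (i < n)%N -> [set` N i] `<` [set` N i.+1].

(** Only an upper bound for the last term is kept, so a chain survives unchanged when the bounding
    set is enlarged, and gains a step when a submodule lies strictly above the bound. *)
Definition chain_below (n : nat) (S : set V) : Prop :=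
  exists2 N, chain n N & [set` N n] `<=` S.

Lemma chain_below_step n (S : set V) (N : submodClosed V) :
  chain_below n S -> S `<` [set` N] -> chain_below n.+1 [set` N].
Proof.
move=> [C C_chain CS] [SN nNS].
(* All terms past [n] are set to [N]; only the one at [n.+1] matters for the chain. *)
exists (fun j => if (j <= n)%N then C j else N); last by rewrite ltnn.
move=> i; rewrite ltnS => i_le; rewrite i_le; case: ltnP => [/C_chain//|n_le].
have -> : i = n by apply/eqP; rewrite eqn_leq i_le.
split; first exact: subset_trans SN.
by move=> NC; apply: nNS; exact: subset_trans CS.
Qed.

Lemma chain_below_sub n (S T : set V) :
  S `<=` T -> chain_below n S -> chain_below n T.
Proof. by move=> ST [C ? CS]; exists C => //; exact: subset_trans ST. Qed.

Lemma chain_below0 (N : submodClosed V) : chain_below 0 [set` N].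
Proof. by exists (fun=> N). Qed.

Lemma chain_le_mod_length (K : realType) n (N : nat -> submodClosed V) :
  chain n N -> (n%:R%:E <= mod_length K V)%E.
Proof. by move=> CN; apply: ereal_sup_ubound; exists n => //; exists N. Qed.

Lemma mod_length_ge0 (K : realType) : (0 <= mod_length K V)%E.
Proof. by apply: (@chain_le_mod_length _ 0 (fun=> span set0)). Qed.

Lemma chain_below_le_mod_length (K : realType) n (S : set V) :
  chain_below n S -> (n%:R%:E <= mod_length K V)%E.
Proof. by move=> [N CN _]; exact: chain_le_mod_length CN. Qed.

End Chains.

(** * Additivity of length along a semilinear short exact sequence *)

(* The outer modules live over B and the middle one over A, so the maps are
   only semilinear along phi. *)
Section ExactSequence.
Variables (A B : comNzRingType) (phi : A -> B).
Variables (V' V'' : lmodType B) (V : lmodType A).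
Variables (f : {additive V' -> V}) (g : {additive V -> V''}).
Hypothesis phi_surj : forall b, exists a, phi a = b.
Hypothesis fZ : forall a x, f (phi a *: x) = a *: f x.
Hypothesis gZ : forall a v, g (a *: v) = phi a *: g v.
Hypothesis f_inj : injective f.
Hypothesis g_surj : forall y, exists v, g v = y.
Hypothesis fgK : forall x, g (f x) = 0.
Hypothesis exact_fg : forall v, g v = 0 -> exists x, f x = v.

(** A scalar of [B] passes through [f] only after being lifted to [A], which is where surjectivity
    of [phi] enters; the same happens for images under [g]. *)
Lemma preim_f_closed (N : submodClosed V) :
  subsemimod_closed [pred x | f x \in N].
Proof.
split; first split; rewrite ?inE ?raddf0 ?rpred0 //.
- by move=> x y; rewrite !inE raddfD; exact: rpredD.
- move=> b x; have [a <-] := phi_surj b.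
  by rewrite !inE fZ; exact: rpredZ.
Qed.

Lemma preim_g_closed (N : submodClosed V'') :
  subsemimod_closed [pred v | g v \in N].
Proof.
split; first split; rewrite ?inE ?raddf0 ?rpred0 //.
- by move=> x y; rewrite !inE raddfD; exact: rpredD.
- by move=> a x; rewrite !inE gZ; exact: rpredZ.
Qed.

Lemma im_f_closed (N : submodClosed V') :
  subsemimod_closed (fun v => `[< exists2 x, x \in N & f x = v >] : bool).
Proof.
split; first split.
- by apply/asboolP; exists 0; rewrite ?rpred0 ?raddf0.
- move=> _ _ /asboolP[x Nx <-] /asboolP[y Ny <-]; apply/asboolP.
  by exists (x + y); rewrite ?rpredD ?raddfD.
- move=> a _ /asboolP[x Nx <-]; apply/asboolP.
  by exists (phi a *: x); rewrite ?rpredZ ?fZ.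
Qed.

Lemma im_g_closed (N : submodClosed V) :
  subsemimod_closed (fun y => `[< exists2 v, v \in N & g v = y >] : bool).
Proof.
split; first split.
- by apply/asboolP; exists 0; rewrite ?rpred0 ?raddf0.
- move=> _ _ /asboolP[x Nx <-] /asboolP[y Ny <-]; apply/asboolP.
  by exists (x + y); rewrite ?rpredD ?raddfD.
- move=> b _ /asboolP[x Nx <-]; apply/asboolP.
  by have [a <-] := phi_surj b; exists (a *: x); rewrite ?rpredZ ?gZ.
Qed.

Let preim_f N := submod_of (preim_f_closed N).
Let preim_g N := submod_of (preim_g_closed N).
Let im_f N := submod_of (im_f_closed N).
Let im_g N := submod_of (im_g_closed N).

(* By exactness, each strict inclusion N i < N i.+1 stays strict after taking
   preimages under f or after taking images under g. *)
Lemma chain_split n (N : nat -> submodClosed V) : chain n N ->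
  exists a b, [/\ (n <= a + b)%N, chain_below a [set` preim_f (N n)]
    & chain_below b [set` im_g (N n)]].
Proof.
elim: n => [|n IHn] CN.
  by exists 0%N, 0%N; split=> //; exact: chain_below0.
have [i /ltnW i_lt|a [b [n_le Ca Cb]]] := IHn; first exact: CN.
have [NS nNS] := CN n (ltnSn n).
have fS : [set` preim_f (N n)] `<=` [set` preim_f (N n.+1)].
  by move=> x; exact: NS.
have gS : [set` im_g (N n)] `<=` [set` im_g (N n.+1)].
  by move=> _ /asboolP[v Nv <-]; apply/asboolP; exists v => //; exact: NS.
have [fS'|nfS] := pselect ([set` preim_f (N n.+1)] `<=` [set` preim_f (N n)]);
  last first.
  exists a.+1, b; split; first by rewrite addSn ltnS.
    exact: chain_below_step Ca _.
  exact: chain_below_sub gS Cb.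
have [gS'|ngS] := pselect ([set` im_g (N n.+1)] `<=` [set` im_g (N n)]);
  last first.
  exists a, b.+1; split; first by rewrite addnS ltnS.
    exact: chain_below_sub fS Ca.
  exact: chain_below_step Cb _.
exfalso; apply: nNS => v Nv.
have /gS' /asboolP[w Nw gw] : [set` im_g (N n.+1)] (g v).
  by apply/asboolP; exists v.
have [|x fx] := @exact_fg (v - w); first by rewrite raddfB gw subrr.
have Nfx : f x \in N n.+1 by rewrite fx submodB //; exact: NS.
have {Nfx} : f x \in N n := fS' x Nfx.
rewrite fx => vw; have : v - w + w \in N n by rewrite rpredD.
by rewrite subrK.
Qed.

(** The images under [f] of the first chain lie in the kernel of [g], hence below the preimage of
    every submodule of [V'']; the preimages of the second chain are then stacked on top. Strictness
    comes from injectivity of [f] below and surjectivity of [g] above. *)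
Lemma chain_glue a b (N' : nat -> submodClosed V')
    (N'' : nat -> submodClosed V'') : chain a N' -> chain b N'' ->
  chain_below (a + b) [set` preim_g (N'' b)].
Proof.
move=> CN'; elim: b => [|b IHb] CN''.
  rewrite addn0; exists (im_f \o N') => [i /CN'[NS nNS]|_ /asboolP[x _ <-]].
    split=> [_ /asboolP[x Nx <-]|h].
      by apply/asboolP; exists x => //; exact: NS.
    apply: nNS => x Nx; have /asboolP[] : [set` im_f (N' i)] (f x).
      by apply: h; apply/asboolP; exists x.
    by move=> y Ny /f_inj <-.
  by change (g (f x) \in N'' 0%N); rewrite fgK rpred0.
rewrite addnS; apply: chain_below_step.
  by apply: IHb => i /ltnW; exact: CN''.
have [NS nNS] := CN'' b (ltnSn b); split=> [v|h]; first exact: NS.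
by apply: nNS => y; have [v <-] := g_surj y; move=> Nv; exact: (h v).
Qed.

(** Splitting a chain of [V] bounds its length from above, and gluing chains of [V'] and [V'']
    bounds it from below. *)
Lemma mod_length_exact (K : realType) :
  mod_length K V = (mod_length K V' + mod_length K V'')%E.
Proof.
apply/eqP; rewrite eq_le; apply/andP; split.
  apply/ereal_supP => _ [n [N /chain_split[a [b [n_le Ca Cb]]]] <-].
  apply: le_trans (leeD (chain_below_le_mod_length K Ca)
                        (chain_below_le_mod_length K Cb)).
  by rewrite -EFinD lee_fin -natrD ler_nat.
have VG a b (N' : nat -> submodClosed V') (N'' : nat -> submodClosed V'')
    (CN' : chain a N') (CN'' : chain b N'') :
    (a%:R%:E + b%:R%:E <= mod_length K V)%E.
  rewrite -EFinD -natrD; apply: chain_below_le_mod_length.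
  exact: chain_glue CN' CN''.
(* The two suprema are taken one after the other, each time moving the other summand across the
   inequality; this subtraction needs finite values, so the infinite case is settled first. *)
have [->|V_lty] := eqVneq (mod_length K V) +oo%E; first exact: leey.
have V_fin : mod_length K V \is a fin_num.
  by rewrite ge0_fin_numE ?mod_length_ge0 // ltey.
have le_fin x : (x <= mod_length K V)%E -> (0 <= x)%E -> x \is a fin_num.
  by move=> xV x0; rewrite ge0_fin_numE // (le_lt_trans xV) // ltey.
have V''le : (mod_length K V'' <= mod_length K V)%E.
  apply/ereal_supP => _ [b [N'' CN''] <-].
  (* Gluing onto a chain of length 0 in [V'] bounds the length of [V''] alone. *)
  by have := @VG 0%N b (fun=> span set0) N''; rewrite add0e; exact.
have V''fin := le_fin _ V''le (mod_length_ge0 _ _).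
rewrite -leeBrDr //; apply/ereal_supP => _ [a [N' CN'] <-].
rewrite leeBrDr // addeC -leeBrDr //.
apply/ereal_supP => _ [b [N'' CN''] <-].
by rewrite leeBrDr // addeC; exact: VG CN' CN''.
Qed.

End ExactSequence.

(** * Additive maps induced on quotients *)

Lemma quotmod_piB (A : comNzRingType) (V : lmodType A) (S : set V) (u v : V) :
  quotmod_pi S (u - v) = quotmod_pi S u - quotmod_pi S v.
Proof. by apply/eqP; rewrite eq_sym subr_eq -quotmod_piD subrK. Qed.

Section QuotientMap.
Variables (A B : comNzRingType) (V : lmodType A) (W : lmodType B).
Variables (S : set V) (T : set W) (f : {additive V -> W}).
Hypothesis fST : forall v, v \in span S -> f v \in span T.

Definition quotmod_map (u : quotmod S) : quotmod T := quotmod_pi T (f (repr u)).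

Lemma quotmod_map_pi v : quotmod_map (quotmod_pi S v) = quotmod_pi T (f v).
Proof.
apply/eqP; rewrite quotmod_pi_eq -raddfB; apply: fST.
by rewrite -quotmod_pi_eq quotmod_repr.
Qed.

Lemma quotmod_map_is_additive : zmod_morphism quotmod_map.
Proof.
move=> u v; rewrite -[u]quotmod_repr -[v]quotmod_repr -quotmod_piB.
by rewrite !quotmod_map_pi raddfB quotmod_piB.
Qed.

End QuotientMap.

(** * The extension of R by M given by the idealization *)

Section IdealizationMaps.
Variables (R : comNzRingType) (M : lmodType R).
Local Notation RM := (idealization M).

Definition idealization_in (x : M) : RM^o := (0, x).
Definition idealization_fst (u : RM^o) : R^o := u.1.

Lemma idealization_in_is_additive : zmod_morphism idealization_in.
Proof. by move=> x y; congr pair; rewrite /= subr0. Qed.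

Lemma idealization_fst_is_additive : zmod_morphism idealization_fst.
Proof. by []. Qed.

HB.instance Definition _ := GRing.isZmodMorphism.Build M RM^o idealization_in
  idealization_in_is_additive.
HB.instance Definition _ := GRing.isZmodMorphism.Build RM^o R^o idealization_fst
  idealization_fst_is_additive.

Lemma idealization_in_scale (a : RM^o) x :
  idealization_in (a.1 *: x) = a *: idealization_in x.
Proof. by congr pair => /=; rewrite ?mulr0 // scale0r addr0. Qed.

(** The sequence 0 -> M / W -> (R |x M) / X -> R / U -> 0 is exact, because X is the product of U
    and W. *)
Lemma mod_length_idealization (K : realType) (X : submodClosed RM^o)
    (U : submodClosed R^o) (W : submodClosed M) :
  (forall u : RM, (u \in X) = (u.1 \in U) && (u.2 \in W)) ->
  mod_length K (quotmod [set` X])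
    = (mod_length K (quotmod [set` U]) + mod_length K (quotmod [set` W]))%E.
Proof.
move=> XE; rewrite addeC.
have in_sub x : x \in span [set` W] -> idealization_in x \in span [set` X].
  by rewrite !span_submod XE /= => ->; rewrite andbT; exact: rpred0.
have fst_sub u : u \in span [set` X] -> idealization_fst u \in span [set` U].
  by rewrite !span_submod XE => /andP[].
pose f : {additive quotmod [set` W] -> quotmod [set` X]} :=
  HB.pack (quotmod_map [set` X] idealization_in)
    (GRing.isZmodMorphism.Build _ _ _ (quotmod_map_is_additive in_sub)).
pose g : {additive quotmod [set` X] -> quotmod [set` U]} :=
  HB.pack (quotmod_map [set` U] idealization_fst)
    (GRing.isZmodMorphism.Build _ _ _ (quotmod_map_is_additive fst_sub)).
have fE x : f (quotmod_pi _ x) = quotmod_pi _ (idealization_in x).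
  exact: quotmod_map_pi.
have gE u : g (quotmod_pi _ u) = quotmod_pi _ (idealization_fst u).
  exact: quotmod_map_pi.
have pi0 (A : comNzRingType) (V : lmodType A) (N : submodClosed V) v :
    (quotmod_pi [set` N] v == 0) = (v \in N).
  rewrite -(scale0r (quotmod_pi [set` N] 0)) -quotmod_piZ scale0r.
  by rewrite quotmod_pi_eq subr0 span_submod.
(* The first projection R |x M -> R plays the role of [phi]: R |x M acts through it on both outer
   terms. *)
apply: (@mod_length_exact _ _ (fun a : RM => a.1) _ _ _ f g).
- by move=> b; exists (b, 0).
- move=> a x; rewrite -[x]quotmod_repr -quotmod_piZ !fE idealization_in_scale.
  exact: quotmod_piZ.
- move=> a u; rewrite -[u]quotmod_repr -quotmod_piZ !gE -quotmod_piZ.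
  by [].
- move=> x y /eqP; rewrite -[x]quotmod_repr -[y]quotmod_repr !fE quotmod_pi_eq.
  rewrite -raddfB span_submod XE => /andP[_ /= Wxy].
  by apply/eqP; rewrite quotmod_pi_eq span_submod.
- move=> y; exists (quotmod_pi [set` X] ((repr y : R, 0) : RM)); rewrite gE.
  exact: quotmod_repr.
- move=> x; rewrite -[x]quotmod_repr fE gE; apply/eqP.
  by rewrite pi0 rpred0.
(* If the first component of u lies in U, then u differs from (0, u.2) by (u.1, 0), which is in X;
   so the class of u.2 is the required preimage. *)
- move=> u; rewrite -[u]quotmod_repr gE => /eqP; rewrite pi0 => Uu.
  exists (quotmod_pi [set` W] (repr u : RM).2); rewrite fE; apply/eqP.
  rewrite eq_sym quotmod_pi_eq span_submod.
  have -> : (repr u : RM) - idealization_in (repr u : RM).2 = ((repr u).1, 0).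
    by congr pair; rewrite /= ?subr0 ?subrr.
  by rewrite XE rpred0 andbT.
Qed.

End IdealizationMaps.

(** * Generators of IV and of powers of ideals *)

Section IdealLemmas.
Variable R : comNzRingType.
Implicit Types S : {pred R}.

Lemma ideal_mod_gen S (V : lmodType R) a x :
  a \in S -> a *: x \in ideal_mod S V.
Proof. by move=> Sa; apply: mem_span; exists a => //; exists x. Qed.

Lemma ideal_mod_self S a : a \in S -> a \in ideal_mod S R^o.
Proof. by move=> /(@ideal_mod_gen S R^o a 1); rewrite [_ *: _]mulr1. Qed.

Lemma ideal_mod_ind S (V : lmodType R) (P : {pred V}) :
  subsemimod_closed P -> (forall a x, a \in S -> a *: x \in P) ->
  {subset ideal_mod S V <= P}.
Proof.
move=> P_closed SP; apply: span_sub_pred => // _ [a Sa [x _ <-]]; exact: SP.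
Qed.

Lemma ideal_mod_sub S S' (V : lmodType R) :
  {subset S <= S'} -> {subset ideal_mod S V <= ideal_mod S' V}.
Proof.
move=> SS'; apply: span_sub => _ [a Sa [x _ <-]].
by apply: ideal_mod_gen; exact: SS'.
Qed.

Lemma ideal_mod_submod (N : submodClosed R^o) :
  {subset ideal_mod N R^o <= N}.
Proof.
apply: span_sub => _ [a Na [x _ <-]].
by rewrite [_ *: _]mulrC; exact: (@rpredZ _ _ N x a Na).
Qed.

(** Together with [scale_scalar_closed], this lets a membership claim about a product be checked on
    generators of one factor while the other is fixed. *)
Lemma scale_vec_closed (V : lmodType R) (x : V) (N : submodClosed V) :
  subsemimod_closed [pred b : R^o | b *: x \in N].
Proof.
split; first split.
- by rewrite inE scale0r rpred0.
- by move=> b c; rewrite !inE scalerDl; exact: rpredD.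
- by move=> c b; rewrite !inE -scalerA; exact: rpredZ.
Qed.

Lemma scale_scalar_closed (V : lmodType R) (a : R) (N : submodClosed V) :
  subsemimod_closed [pred x | a *: x \in N].
Proof.
split; first split.
- by rewrite inE scaler0 rpred0.
- by move=> u v; rewrite !inE scalerDr; exact: rpredD.
- by move=> c u; rewrite !inE scalerA mulrC -scalerA; exact: rpredZ.
Qed.

Lemma ideal_pow0_mem (I : {pred R}) : 1 \in ideal_pow I 0.
Proof. by apply: mem_span; exists (fun=> 0); [case|rewrite big_ord0]. Qed.

Lemma ideal_powS_mem (I : {pred R}) n a b :
  a \in I -> b \in ideal_pow I n -> a * b \in ideal_pow I n.+1.
Proof.
move=> Ia; apply: (span_sub_pred (scale_scalar_closed (V := R^o) a (span _))).
move=> _ [x Ix <-]; apply: mem_span.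
(* The tuple [x] with [a] prepended at index [ord0]. *)
exists (fun i => if unlift ord0 i is Some j then x j else a) => [i /=|].
  by case: unlift => // j; exact: Ix.
rewrite big_ord_recl /= unlift_none; congr (_ * _).
by apply: eq_bigr => i _; rewrite liftK.
Qed.

End IdealLemmas.

(** * Ideals of the form I |x IM *)

Section IdealizationIdeals.
Variables (R : comNzRingType) (M : lmodType R).
Local Notation RM := (idealization M).
Implicit Types (S : {pred R}) (I : idealr R).

Lemma idealizationM (u v : RM) :
  u * v = (u.1 * v.1, u.1 *: v.2 + v.1 *: u.2).
Proof. by []. Qed.

(** Since (0, x) squares to zero, only two terms of the binomial expansion survive. Using [n.+1]
    avoids a truncated predecessor in the exponent. *)
Lemma idealizationX (u : RM) n :
  u ^+ n.+1 = (u.1 ^+ n.+1, (n.+1%:R * u.1 ^+ n) *: u.2).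
Proof.
elim: n => [|n IHn]; first by rewrite !expr1 expr0 mulr1 scale1r; case: u.
rewrite exprS IHn idealizationM /= -exprS scalerA -scalerDl; congr (_, _ *: _).
by rewrite mulrCA -exprS -[n.+2]addn1 natrD mulrDl mul1r.
Qed.

Lemma ideal_mod_scale S b x :
  b \in ideal_mod S R^o -> b *: x \in ideal_mod S M.
Proof.
move=> b_in.
apply: (ideal_mod_ind (scale_vec_closed x (span _)) _ b_in) => a c Sa.
change ((a * c) *: x \in ideal_mod S M); rewrite -scalerA; exact: ideal_mod_gen.
Qed.

(* For the ideal I generated by S, this is I |x IM. *)
Definition ideal_pair S : {pred RM} :=
  fun u => (u.1 \in ideal_mod S R^o) && (u.2 \in ideal_mod S M).

Lemma ideal_pair_closed S : subsemimod_closed (V := RM^o) (ideal_pair S).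
Proof.
split; first split.
- by apply/andP; split; exact: rpred0.
- move=> u v /andP[u1 u2] /andP[v1 v2].
  by apply/andP; split; exact: rpredD.
- move=> a u /andP[u1 u2]; apply/andP; split.
    exact: (@rpredZ _ _ (ideal_mod S R^o) a.1 u.1 u1).
  by apply: rpredD; [exact: rpredZ|exact: ideal_mod_scale].
Qed.

Lemma ideal_pair_sub S S' :
  {subset S <= S'} -> {subset ideal_pair S <= ideal_pair S'}.
Proof.
by move=> SS' u /andP[u1 u2]; apply/andP; split; exact: ideal_mod_sub SS' _ _.
Qed.

(** With [mem_snd_closed], this reduces membership of (r, 0) and (0, x) in an ideal to generators of
    r and of x. *)
Lemma mem_fst_closed (N : submodClosed RM^o) :
  subsemimod_closed (fun b : R^o => ((b, 0) : RM) \in N).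
Proof.
split; first split.
- exact: (rpred0 N).
- move=> b c bN cN; have := rpredD bN cN.
  by congr (is_true (_ \in N)); congr pair; rewrite /= addr0.
- move=> b c cN; have := @rpredZ _ _ N ((b, 0) : RM) _ cN.
  by congr (is_true (_ \in N)); congr pair; rewrite /= !scaler0 addr0.
Qed.

Lemma mem_snd_closed (N : submodClosed RM^o) :
  subsemimod_closed (fun y : M => ((0, y) : RM) \in N).
Proof.
split; first split.
- exact: (rpred0 N).
- move=> b c bN cN; have := rpredD bN cN.
  by congr (is_true (_ \in N)); congr pair; rewrite /= addr0.
- move=> b c cN; have := @rpredZ _ _ N ((b, 0) : RM) _ cN.
  by congr (is_true (_ \in N)); congr pair; rewrite /= ?mulr0 // scale0r addr0.
Qed.

(** The elements (a, 0) with a in [S] already generate the whole pair ideal, as (a, 0)(c, 0) = (ac,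
    0) and (a, 0)(0, y) = (0, ay). Any [T] trapped between the two therefore generates it too, and
    need not be computed exactly. *)
Lemma ideal_mod_pair S (T : {pred RM}) :
    {subset T <= ideal_pair S} -> (forall a, a \in S -> ((a, 0) : RM) \in T) ->
  ideal_mod T RM^o =i ideal_pair S.
Proof.
move=> TS ST u; apply/idP/idP.
  apply: span_sub_pred; first exact: ideal_pair_closed.
  move=> _ [a Ta [x _ <-]]; rewrite [_ *: _]mulrC.
  by have [_] := ideal_pair_closed S; apply; exact: TS.
have TM (a : R) (v : RM) :
    a \in S -> (a * v.1, a *: v.2) \in ideal_mod T RM^o.
  move=> Sa; apply: mem_span; exists ((a, 0) : RM); first exact: ST.
  by exists v => //; congr pair; rewrite /= scaler0 addr0.
case: u => r x /andP[/= r_in x_in].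
have -> : ((r, x) : RM) = ((r, 0) : RM) + ((0, x) : RM).
  by congr pair; rewrite /= ?addr0 ?add0r.
apply: (@rpredD RM^o).
  apply: (ideal_mod_ind (mem_fst_closed _) _ r_in) => a c Sa.
  by have := TM a (c, 0) Sa; rewrite /= scaler0.
apply: (ideal_mod_ind (mem_snd_closed _) _ x_in) => a y Sa.
by have := TM a (0, y) Sa; rewrite /= mulr0.
Qed.

(** By induction on the number of factors: in (a, z)(b, y) = (ab, ay + bz), with a in I, z in IM, b
    in I^n and y in I^n M, every term gains one power of I. *)
Lemma ideal_pow_pair I n :
  {subset ideal_pow (idealization_ideal M I) n <= ideal_pair (ideal_pow I n)}.
Proof.
apply: (span_sub_pred (@ideal_pair_closed _)).
move=> _ [x Ix <-]; elim: n x Ix => [|n IHn] x Ix.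
  rewrite big_ord0; apply/andP; split; last exact: rpred0.
  exact: ideal_mod_self (ideal_pow0_mem _).
rewrite big_ord_recl; have /andP[/= a_in z_in] := Ix ord0.
have /andP[b_in y_in] := IHn (x \o lift ord0) (fun i => Ix _).
rewrite [X in X \in _]idealizationM.
set a := (x ord0).1 in a_in *; set z := (x ord0).2 in z_in *.
set b := (X in X.1) in b_in y_in *.
have {}b_in : b.1 \in ideal_pow I n by exact: ideal_mod_submod b_in.
apply/andP; split=> /=.
  exact/ideal_mod_self/ideal_powS_mem.
apply: rpredD.
  apply: (ideal_mod_ind (scale_scalar_closed a _) _ y_in) => c y c_in.
  change (a *: (c *: y) \in ideal_mod (ideal_pow I n.+1) M).
  rewrite scalerA; apply: ideal_mod_gen; exact: ideal_powS_mem.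
apply: (ideal_mod_ind (scale_scalar_closed b.1 _) _ z_in) => c y c_in.
change (b.1 *: (c *: y) \in ideal_mod (ideal_pow I n.+1) M).
rewrite scalerA mulrC; apply: ideal_mod_gen; exact: ideal_powS_mem.
Qed.

End IdealizationIdeals.
Arguments ideal_pair {R} M S _.

(** * Powers and Frobenius powers in the idealization *)

Section SIdeals.
Variables (R : comNzRingType) (M : lmodType R).
Local Notation RM := (idealization M).
Implicit Types I : idealr R.

(** The map sending a to (a, 0) is multiplicative, so it carries n-fold products to n-fold
    products. *)
Lemma ideal_pow_inl I n a : a \in ideal_pow I n ->
  ((a, 0) : RM) \in ideal_pow (idealization_ideal M I) n.
Proof.
apply: (span_sub_pred (mem_fst_closed (span _))) => _ [x Ix <-].
apply: mem_span; exists (fun i => (x i, 0)) => [i /=|].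
  by apply/andP; split; [exact: Ix|exact: rpred0].
elim/big_rec2: _ => // i y1 y2 _ ->; rewrite idealizationM /=.
by rewrite !scaler0 addr0.
Qed.

Lemma frobenius_pow_inl I q a : (0 < q)%N -> a \in frobenius_pow I q ->
  ((a, 0) : RM) \in frobenius_pow (idealization_ideal M I) q.
Proof.
move=> q_gt0; apply: (span_sub_pred (mem_fst_closed (span _))) => _ [x Ix <-].
apply: mem_span; exists ((x, 0) : RM).
  by apply/andP; split; [exact: Ix|exact: rpred0].
by rewrite -(prednK q_gt0) [LHS]idealizationX /= scaler0.
Qed.

(* (a, x)^q = (a^q, q a^(q-1) x), where q = 0 in R unless q = 1. *)
Lemma frobenius_pow_pair I p e : p \in [pchar R] ->
  {subset frobenius_pow (idealization_ideal M I) (p ^ e)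
     <= ideal_pair M (frobenius_pow I (p ^ e))}.
Proof.
move=> p_char; have p_gt0 := prime_gt0 (pcharf_prime p_char).
apply: (span_sub_pred (@ideal_pair_closed _ _ _)) => _ [u /andP[Iu1 Iu2] <-].
have Fu1 a : a \in I -> a ^+ (p ^ e) \in frobenius_pow I (p ^ e).
  by move=> Ia; apply: mem_span; exists a.
have q_gt0 : (0 < p ^ e)%N by rewrite expn_gt0 p_gt0.
rewrite -[in u ^+ _](prednK q_gt0) idealizationX prednK //.
apply/andP; split=> /=; first exact/ideal_mod_self/Fu1.
case: e Fu1 {q_gt0} => [|e] Fu1.
  rewrite expn0 expr0 mulr1 scale1r; apply: ideal_mod_sub Iu2 => a /Fu1.
  by rewrite expn0 expr1.
by rewrite natrX exprS (pcharf0 p_char) !mul0r scale0r; exact: rpred0.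
Qed.

(** An application of [ideal_mod_pair]: the upper inclusion is checked separately on the ordinary
    and the Frobenius power, the lower one by embedding R as the pairs (a, 0). *)
Lemma ideal_mod_s_ideal (K : realType) (s : K) p e I1 I2 (u : RM) :
  p \in [pchar R] ->
  (u \in ideal_mod (s_ideal p s (idealization_ideal M I1)
                      (idealization_ideal M I2) e) RM^o)
  = (u.1 \in ideal_mod (s_ideal p s I1 I2 e) R^o)
    && (u.2 \in ideal_mod (s_ideal p s I1 I2 e) M).
Proof.
move=> p_char; have p_gt0 := prime_gt0 (pcharf_prime p_char).
apply: (@ideal_mod_pair _ _ (s_ideal p s I1 I2 e)) => [v|a].
  move=> /asboolP[x [y [x_in y_in ->]]].
  have [[_ pairD] _] := @ideal_pair_closed _ M (s_ideal p s I1 I2 e).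
  apply: pairD.
    apply: ideal_pair_sub (ideal_pow_pair x_in) => a a_in; apply/asboolP.
    by exists a, 0; split; rewrite ?addr0 //; exact: (rpred0 (span _)).
  apply: ideal_pair_sub (frobenius_pow_pair p_char y_in) => a a_in.
  apply/asboolP.
  by exists 0, a; split; rewrite ?add0r //; exact: (rpred0 (span _)).
move=> /asboolP[x [y [x_in y_in ->]]]; apply/asboolP.
exists (x, 0), (y, 0); split; first exact: ideal_pow_inl.
  by apply: frobenius_pow_inl => //; rewrite expn_gt0 p_gt0.
by congr pair; rewrite /= addr0.
Qed.

End SIdeals.

(** * Primes and dimension of the idealization *)

Section KrullDim.
Variables (R : comNzRingType) (M : lmodType R).
Local Notation RM := (idealization M).

Definition idealization_prime (P : prime_idealr R) : {pred RM} :=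
  fun u => u.1 \in P.

Lemma idealization_prime_idealr (P : prime_idealr R) :
  idealr_closed (idealization_prime P).
Proof.
split=> [||a u v Pu Pv]; first exact: (rpred0 P).
  by rewrite [_ \in _]idealr1.
by apply: (rpredD (_ : a.1 * u.1 \in P) Pv); exact: idealMr.
Qed.

Lemma idealization_prime_closed (P : prime_idealr R) :
  prime_idealr_closed (idealization_prime P).
Proof. by move=> u v; rewrite -[_ || _]prime_idealrM. Qed.

HB.instance Definition _ P :=
  isIdealr.Build RM (idealization_prime P) (idealization_prime_idealr P).
HB.instance Definition _ P :=
  isPrimeIdealrClosed.Build RM (idealization_prime P)
    (@idealization_prime_closed P).

Definition contracted_prime (P : prime_idealr RM) : {pred R} :=
  fun a => ((a, 0) : RM) \in P.

Lemma contracted_prime_idealr (P : prime_idealr RM) :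
  idealr_closed (contracted_prime P).
Proof.
split=> [||a u v Pu Pv]; first exact: (rpred0 P).
  by rewrite [_ \in _](idealr1 P).
have := rpredD (idealMr ((a, 0) : RM) Pu) Pv.
by congr (is_true (_ \in P)); congr pair; rewrite /= !scaler0 !addr0.
Qed.

Lemma contracted_prime_closed (P : prime_idealr RM) :
  prime_idealr_closed (contracted_prime P).
Proof.
move=> a b; rewrite -[_ || _](prime_idealrM P).
by congr (is_true (_ \in P)); congr pair; rewrite /= !scaler0 addr0.
Qed.

HB.instance Definition _ P :=
  isIdealr.Build R (contracted_prime P) (contracted_prime_idealr P).
HB.instance Definition _ P :=
  isPrimeIdealrClosed.Build R (contracted_prime P) (@contracted_prime_closed P).

(** A prime contains each (0, x), whose square is zero, so the second component never affects
    membership. Hence contraction keeps inclusions of primes strict. *)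
Lemma mem_contracted_prime (P : prime_idealr RM) (u : RM) :
  (u.1 \in contracted_prime P) = (u \in P).
Proof.
have nil_in (x : M) : ((0, x) : RM) \in P.
  have : ((0, x) : RM) * (0, x) \in P.
    have -> : ((0, x) : RM) * (0, x) = 0; last exact: rpred0.
    by congr pair; rewrite /= ?mulr0 // scale0r addr0.
  by rewrite prime_idealrM orbb.
have uE : u = ((u.1, 0) : RM) + ((0, u.2) : RM).
  by case: u => a x; congr pair; rewrite /= ?addr0 ?add0r.
by rewrite {2}uE rpredDr.
Qed.

(** The sets of chain lengths are equal, so the suprema agree even where the default value 0 is
    taken. *)
Lemma krull_dim_idealization : krull_dim RM = krull_dim R.
Proof.
congr (supremum _ _); apply/seteqP; split=> n [P P_chain].
  exists (fun i => contracted_prime (P i) : prime_idealr R).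
  move=> i /P_chain[PS nPS].
  split=> [a|h]; first exact: PS.
  by apply: nPS => u; rewrite /= -!mem_contracted_prime; exact: h.
exists (fun i => idealization_prime (P i) : prime_idealr RM).
move=> i /P_chain[PS nPS].
split=> [u|h]; first exact: PS.
by apply: nPS => a; exact: (h (a, 0)).
Qed.

End KrullDim.

(** * Nonnegativity and passage to the limit *)

Section SMultGe0.
Variables (K : realType) (p : nat) (s : K) (A : comNzRingType).
Variables (I J : idealr A) (N : lmodType A).

Lemma h_seq_ge0 e : (0 <= h_seq p s I J N e)%E.
Proof.
by rewrite mule_ge0 ?mod_length_ge0 // lee_fin invr_ge0 exprn_ge0.
Qed.

(** Nonnegative extended reals never give an indeterminate sum; this justifies distributing the
    normalizing factor, whatever its sign, and adding the limits. *)
Lemma h_mult_ge0 : cvgn (h_seq p s I J N) -> (0 <= h_mult p s I J N)%E.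
Proof. by move=> /lime_ge; apply; apply: nearW => e; exact: h_seq_ge0. Qed.

End SMultGe0.

(** Additivity already holds for each [e], since both sides are normalized by the same power of p
    once the dimensions agree. *)
Lemma h_seq_idealization (K : realType) (R : comNzRingType) (M : lmodType R)
    (p : nat) (s : K) (I1 I2 : idealr R) : p \in [pchar R] ->
  h_seq p s (idealization_ideal M I1) (idealization_ideal M I2)
      (idealization M)^o
    = (h_seq p s I1 I2 R^o \+ h_seq p s I1 I2 M)%E.
Proof.
move=> p_char; apply/funext => e; rewrite /h_seq krull_dim_idealization.
rewrite -ge0_muleDl ?mod_length_ge0 //; congr (_ * _)%E.
apply: mod_length_idealization => u; exact: ideal_mod_s_ideal.
Qed.

Theorem lemma4p7 (K : realType) (R : comNzRingType) (m : idealr R)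
    (p : nat) (M : lmodType R) (s : K) (I1 I2 : idealr R)
    (R_noetherian : noetherian R)
    (R_local : local_ring m)
    (R_char : p \in [pchar R])
    (R_dim : (0 < krull_dim R)%N)
    (M_fg : finitely_generated (predT : {pred M}))
    (s_gt0 : 0 < s)
    (I1_primary : primary_to m I1)
    (I2_primary : primary_to m I2)
    (h_R_exists : cvgn (h_seq p s I1 I2 R^o))
    (h_M_exists : cvgn (h_seq p s I1 I2 M)) :
  let J1 : idealr (idealization M) := idealization_ideal M I1 in
  let J2 : idealr (idealization M) := idealization_ideal M I2 in
  s_mult p s J1 J2 (idealization M)^o
    = (s_mult p s I1 I2 R^o + s_mult p s I1 I2 M)%E.
Proof.
move=> J1 J2; rewrite /s_mult krull_dim_idealization -ge0_muleDl ?h_mult_ge0 //.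
congr (_ * _)%E; rewrite /h_mult h_seq_idealization // limeD //.
(* Convergence in the extended reals allows the limit +oo, so the sum of the limits has to be shown
   well defined. *)
by rewrite ge0_adde_def ?inE ?h_mult_ge0.
Qed.
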